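(* Let $G$ be a graph with $n$ vertices and $k \in [n]$. The following statements are equivalent: (1) $G$ has a pinnacle set of size $k$. (2) The set $M_{n,k} = \{n-k+1, \ldots, n-1, n\}$ is a pinnacle set of $G$. (3) $G$ has an independent set $I$ of size $k$ such that every vertex of $G$ is reachable (by a path in $G$, possibly of length $0$) from some vertex of $I$.
   Context: Graphs are finite and simple, and $[n] = \{1,2,\ldots,n\}$. A labeling of a graph $G$ with $n$ vertices is a bijection $\lambda : V(G) \to [n]$. The label $\lambda(u)$ of a vertex $u$ is a pinnacle of $(G,\lambda)$ if $\lambda(u) > \lambda(v)$ for every neighbor $v$ of $u$ (so the label of an isolated vertex is vacuously a pinnacle). The pinnacle set of $(G,\lambda)$ is the set of all pinnacles of $(G,\lambda)$. A subset $S \subseteq [n]$ is a pinnacle set of $G$ if there is a labeling $\lambda$ of $G$ such that $S$ is the pinnacle set of $(G,\lambda)$. *)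

(* Defs.v *)
From mathcomp Require Import all_boot.

Set Implicit Arguments.
Unset Strict Implicit.
Unset Printing Implicit Defensive.

(* A finite simple graph is a finType of vertices together with a
   symmetric and irreflexive adjacency relation.  Labels live in
   'I_n.+1 = {0, ..., n}, and [n] = {1, ..., n} is the subset [labels n]. *)

Definition labels (n : nat) : {set 'I_n.+1} := [set i : 'I_n.+1 | 1 <= i <= n].

(* M_{n,k} = {n-k+1, ..., n}; meaningful for k <= n, the subtraction being
   truncated. *)
Definition top_labels (n k : nat) : {set 'I_n.+1} :=
  [set i : 'I_n.+1 | n - k + 1 <= i <= n].

Section Graph.

Variables (T : finType) (e : rel T).

(* A bijection from T onto [n]. *)
Definition labeling (n : nat) (lam : T -> 'I_n.+1) : Prop :=
  injective lam /\ lam @: [set: T] = labels n.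

Definition is_pinnacle (n : nat) (lam : T -> 'I_n.+1) (u : T) : bool :=
  [forall v : T, e u v ==> (lam v < lam u)].

Definition pinnacles (n : nat) (lam : T -> 'I_n.+1) : {set 'I_n.+1} :=
  [set lam u | u : T & is_pinnacle lam u].

Definition pinnacle_set (n : nat) (S : {set 'I_n.+1}) : Prop :=
  S \subset labels n /\
  exists lam : T -> 'I_n.+1, labeling lam /\ pinnacles lam = S.

Definition independent (I : {set T}) : Prop :=
  forall u v : T, u \in I -> v \in I -> ~~ e u v.

End Graph.

(* Main.v *)
Require Import Defs.
From mathcomp Require Import all_boot.

(** The pinnacles of a labeling sit at the vertices that are local maxima.
    Two such vertices cannot be adjacent, and from any vertex one can climb
    along edges with increasing labels until a local maximum is met; since
    adjacency is symmetric, the local maxima thus form an independent set from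
    which everything is reachable ([pinnacle_vertices_independent] and
    [pinnacle_vertices_reach]).

    Conversely, let [I] be an independent set from which everything is
    reachable.  Give each vertex its depth, the distance to [I]
    ([exists_depth]), and hand out the labels from [n] downwards by
    nondecreasing depth ([exists_rank]).  A vertex outside [I] has a neighbor
    of smaller depth, hence of larger label, so it is not a local maximum; a
    vertex of [I] has only neighbors of positive depth, hence of smaller label,
    so it is one.  The vertices of [I] come first in this enumeration and
    therefore carry exactly the [#|I|] largest labels
    ([pinnacle_set_top_labels]).

    So a pinnacle set of size [k] yields a suitable independent set of size
    [k], which yields the top set, which is itself a pinnacle set of size
    [k]. *)

Set Implicit Arguments.
Unset Strict Implicit.
Unset Printing Implicit Defensive.

Lemma card_labels (n : nat) : #|labels n| = n.
Proof.
have -> : labels n = [set~ ord0].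
  apply/setP=> i; rewrite !inE -val_eqE /= -lt0n.
  by have := ltn_ord i; rewrite ltnS => ->; rewrite andbT.
by rewrite cardsC1 card_ord.
Qed.

Lemma card_top_labels (n k : nat) : k <= n -> #|top_labels n k| = k.
Proof.
move=> le_kn.
(* [i |-> n - i] matches ['I_k] with the [k] largest labels. *)
pose f (i : 'I_k) : 'I_n.+1 := inord (n - i).
have fE i : f i = n - i :> nat by rewrite inordK // ltnS leq_subr.
have f_inj : injective f.
  move=> i j /(congr1 val); rewrite /= !fE => eq_ij; apply/val_inj => /=.
  have le_n (l : 'I_k) : l <= n by apply: ltnW; apply: leq_trans le_kn.
  by rewrite -(subKn (le_n i)) eq_ij subKn.
rewrite -[RHS]card_ord -(card_imset _ f_inj); congr #|pred_of_set _|.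
apply/setP=> i; rewrite inE; apply/idP/imsetP => [/andP[lo hi]|[j _ ->]].
  have lt_k : n - i < k by rewrite ltn_subLR // addnC -ltn_subLR // -addn1.
  exists (Ordinal lt_k) => //; apply/val_inj.
  by rewrite /= fE subKn.
by rewrite fE leq_subr andbT addn1 ltn_sub2l // (leq_trans (ltn_ord j)).
Qed.

Lemma top_labels_sub (n k : nat) : top_labels n k \subset labels n.
Proof.
apply/subsetP=> i; rewrite !inE => /andP[lo ->]; rewrite andbT.
by apply: leq_trans lo; rewrite addn1.
Qed.

(** Sorting by [d] breaks its ties, so that positions in the sorted list
    number the elements injectively.  The zeros of [d] form an initial segment
    of that list, hence the last clause. *)
Lemma exists_rank (T : finType) (d : T -> nat) :
  exists r : T -> nat,
    [/\ injective r, forall v, r v < #|T|,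
        forall u v, d u < d v -> r u < r v
      & forall u, d u = 0 -> r u < #|[set v | d v == 0]| ].
Proof.
pose leD := relpre d leq.
have leD_tr : transitive leD by move=> y x z; apply: leq_trans.
have leD_tot : total leD by move=> x y; apply: leq_total.
pose s := sort leD (enum T).
have s_sorted : sorted leD s by apply: sort_sorted.
have s_uniq : uniq s by rewrite sort_uniq enum_uniq.
have s_all v : v \in s by rewrite mem_sort mem_enum.
have mono u v : d u < d v -> index u s < index v s.
  move=> lt_uv; rewrite ltnNge leq_eqVlt; apply/negP => /orP[/eqP eq_ix|lt_vu].
    by move: lt_uv; rewrite (index_inj u (s_all v) (s_all u) eq_ix) ltnn.
  have := sorted_ltn_index leD_tr s_sorted v u (s_all v) (s_all u) lt_vu.
  by rewrite /leD /= leqNgt lt_uv.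
exists (fun v => index v s); split=> //.
- by move=> u v; apply: (index_inj u); apply: s_all.
- by move=> v; rewrite cardE -(size_sort leD) index_mem.
move=> u du0.
(* Every element up to and including [u] is a zero of [d], and there are
   [(index u s).+1] of them. *)
set m := (index u s).+1.
have size_m : size (take m s) = m by rewrite size_takel // index_mem.
rewrite -/m -size_m cardE; apply: uniq_leq_size; first exact: take_uniq.
move=> w /index_ltn; rewrite mem_enum inE ltnS => le_wu.
by rewrite -leqn0 leqNgt -du0; apply/negP => /mono; rewrite ltnNge le_wu.
Qed.

Section Graph.

Variables (T : finType) (e : rel T).
Hypotheses (e_sym : symmetric e) (e_irr : irreflexive e).

Section Labeled.

Variables (n : nat) (lam : T -> 'I_n.+1).
Hypothesis lam_inj : injective lam.

Lemma card_pinnacles : #|pinnacles e lam| = #|[set u | is_pinnacle e lam u]|.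
Proof. by rewrite -(card_imset _ lam_inj). Qed.

Lemma pinnacle_vertices_independent :
  independent e [set u | is_pinnacle e lam u].
Proof.
move=> u v; rewrite !inE => /forallP/(_ v) pin_u /forallP/(_ u) pin_v.
apply/negP=> e_uv; move: pin_u pin_v; rewrite (e_sym v u) e_uv /=.
by move=> lt_vu /(ltn_trans lt_vu); rewrite ltnn.
Qed.

(** Labels are bounded, so climbing to a neighbor of larger label must
    terminate, and it can only terminate at a pinnacle. *)
Lemma pinnacle_vertices_reach (v : T) :
  exists2 u, u \in [set u | is_pinnacle e lam u] & connect e u v.
Proof.
have [m] := ubnP (n - lam v); elim: m v => // m IHm v /ltnSE lt_m.
case: (boolP (is_pinnacle e lam v)) => [pin_v|].
  by exists v; rewrite ?inE ?connect0.
rewrite negb_forall => /existsP[w]; rewrite negb_imply -leqNgt.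
case/andP=> e_vw; rewrite leq_eqVlt => /orP[/eqP/val_inj/lam_inj eq_vw|lt_vw].
  by move: e_vw; rewrite eq_vw e_irr.
have [|u pin_u e_uw] := IHm w.
  apply: leq_trans lt_m; apply: ltn_sub2l => //.
  by apply: leq_trans lt_vw _; rewrite -ltnS.
exists u => //; apply: connect_trans e_uw _.
by apply: connect1; rewrite e_sym.
Qed.

End Labeled.

Definition ball (I : {set T}) (m : nat) : {set T} :=
  iter m (fun A => A :|: [set v | [exists u in A, e u v]]) I.

Lemma mem_ball_connect (I : {set T}) (u v : T) :
  u \in I -> connect e u v -> exists m, v \in ball I m.
Proof.
move=> uI /connectP[p]; elim/last_ind: p v => [|p w IHp] v.
  by move=> _ ->; exists 0.
rewrite rcons_path last_rcons => /andP[path_p e_w] ->.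
have [m ball_m] := IHp _ path_p erefl.
by exists m.+1; rewrite !inE; apply/orP; right; apply/exists_inP;
  exists (last u p).
Qed.

(** The depth is the distance to [I]: on a shortest path to [I], the vertex
    after [v] is a neighbor of smaller depth. *)
Lemma exists_depth (I : {set T}) :
    (forall v, exists2 u, u \in I & connect e u v) ->
  exists d : T -> nat,
    (forall v, (d v == 0) = (v \in I)) /\
    (forall v, v \notin I -> exists2 u, e u v & d u < d v).
Proof.
move=> reach.
have inb v : exists m, v \in ball I m.
  by have [u uI uv] := reach v; apply: mem_ball_connect uv.
exists (fun v => ex_minn (inb v)); split=> v.
  case: ex_minnP => -[|m] vm min_m; first by rewrite eqxx; symmetry.
  by apply/esym/negP => vI; have := min_m 0 vI.
case: ex_minnP => -[|m] vm min_m vI; first by move: vI; rewrite [v \in I]vm.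
move: vm; rewrite /ball iterS -/(ball I m) !inE.
case/orP=> [/min_m|/exists_inP[u um e_uv]]; first by rewrite ltnn.
by exists u => //; case: ex_minnP => l _ /(_ m um).
Qed.

(** Labels are assigned downwards from [n] by increasing depth, which makes
    [I] both the set of local maxima and the set of the first [#|I|] vertices
    in the enumeration. *)
Lemma pinnacle_set_top_labels (I : {set T}) :
    independent e I -> (forall v, exists2 u, u \in I & connect e u v) ->
  pinnacle_set e (top_labels #|T| #|I|).
Proof.
move=> indep /exists_depth[d [d0 d_up]].
have [r [r_inj r_lt r_mono r_top]] := exists_rank d.
set n := #|T| in r_lt *.
pose lam v : 'I_n.+1 := inord (n - r v).
have lamE v : lam v = n - r v :> nat by rewrite inordK // ltnS leq_subr.
have lam_inj : injective lam.
  move=> u v /(congr1 val); rewrite /= !lamE => eq_uv; apply: r_inj.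
  by rewrite -(subKn (ltnW (r_lt u))) eq_uv subKn // ltnW.
have lam_anti u v : d u < d v -> lam v < lam u.
  by move=> /r_mono lt_uv; rewrite !lamE ltn_sub2l.
have pinE : [set u | is_pinnacle e lam u] = I.
  apply/setP=> u; rewrite inE; apply/idP/idP => [/forallP pin_u|uI].
    apply/negPn/negP => /d_up[w e_wu /lam_anti lt_uw].
    by have := pin_u w; rewrite e_sym e_wu /= ltnNge ltnW.
  apply/forallP=> v; apply/implyP=> e_uv; apply: lam_anti.
  have /eqP-> : d u == 0 by rewrite d0.
  by rewrite lt0n d0; apply/negP => /(indep _ _ uI); rewrite e_uv.
have zeroE : [set v | d v == 0] = I by apply/setP=> v; rewrite inE d0.
split; first exact: top_labels_sub.
exists lam; split; first split=> //.
  apply/eqP; rewrite eqEcard card_labels card_imset // cardsT leqnn andbT.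
  apply/subsetP=> _ /imsetP[v _ ->].
  by rewrite inE lamE leq_subr subn_gt0 r_lt.
apply/eqP; rewrite eqEcard card_pinnacles // pinE.
rewrite card_top_labels ?max_card // leqnn andbT.
apply/subsetP=> _ /imsetP[u pin_u ->].
have uI : u \in I by rewrite -pinE inE; rewrite inE in pin_u.
rewrite inE lamE leq_subr andbT addn1 ltn_sub2l //.
by rewrite -zeroE; apply: r_top; apply/eqP; rewrite d0.
Qed.

End Graph.

Theorem theorem2p5 (T : finType) (e : rel T)
    (e_sym : symmetric e) (e_irr : irreflexive e)
    (n k : nat) (cardT : #|T| = n) (hk : 1 <= k <= n) :
  ((exists S : {set 'I_n.+1}, pinnacle_set e S /\ #|S| = k)
     <-> pinnacle_set e (top_labels n k)) /\
  (pinnacle_set e (top_labels n k)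
     <-> exists I : {set T},
           [/\ independent e I, #|I| = k
             & forall v : T, exists2 u : T, u \in I & connect e u v]).
Proof.
have /andP[_ le_kn] := hk.
have set_of_pinnacles (S : {set 'I_n.+1}) : pinnacle_set e S -> #|S| = k ->
    exists I : {set T}, [/\ independent e I, #|I| = k
      & forall v : T, exists2 u : T, u \in I & connect e u v].
  case=> _ [lam [[lam_inj _] <-]]; rewrite card_pinnacles // => cardI.
  exists [set u | is_pinnacle e lam u]; split=> //.
    exact: pinnacle_vertices_independent.
  exact: pinnacle_vertices_reach.
have top_of_set : (exists I : {set T}, [/\ independent e I, #|I| = k
      & forall v : T, exists2 u : T, u \in I & connect e u v]) ->
    pinnacle_set e (top_labels n k).
  case=> I [indep cardI reach]; rewrite -cardI -cardT.
  exact: pinnacle_set_top_labels.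
split; split=> //.
- by case=> S [pinS cardS]; apply/top_of_set/(set_of_pinnacles S).
- by move=> top; exists (top_labels n k); rewrite card_top_labels.
- by move=> top; apply: (set_of_pinnacles _ top); rewrite card_top_labels.
Qed.
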